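(* Fix an integer $\ell \geq 1$. For an integer $n$, write $n_0$ for the least (non-negative) residue of $n \pmod{3}$. Then, as $n \to \infty$, $$ E_{n}(N^{\ell}) \sim c_{\ell}^{(n_0)}\frac{3^{\frac{\ell n}{3}}}{p(n)}, $$ where $$ c_{\ell}^{(n_0)}:=\sum_{j=1}^3 e^{-\frac{2\pi i j n_0}{3}} \cdot \frac{1}{3}\prod_{\substack{k \geq 1 \\ k \neq 3}}\left(1-k^{\ell}3^{-\frac{k\ell}{3}}e^{\frac{2\pi i j k}{3}}\right)^{-1}. $$
   Context: A partition of a natural number $n \geq 0$ is a non-increasing list $\lambda = (\lambda_1, \dots, \lambda_m)$ of positive integers with $\lambda_1 + \dots + \lambda_m = n$; write $\lambda \vdash n$. The norm of $\lambda$ is $N(\lambda) := \prod_{j=1}^{m} \lambda_j$ (the product of its parts). Let $p(n)$ denote the number of partitions of $n$, and let $E_n$ denote expectation under the uniform probability measure on the partitions of $n$, so that for an integer $\ell \geq 1$, $E_n(N^\ell) = \frac{1}{p(n)}\sum_{\lambda \vdash n} N(\lambda)^\ell$. The notation $a_n \sim b_n$ means $a_n/b_n \to 1$ as $n \to \infty$. *)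

(* Defs.v *)
From HB Require Import structures.
From mathcomp Require Import all_boot all_order all_algebra finmap.
From mathcomp Require Import all_classical all_reals all_analysis.
From mathcomp Require Import complex.

Set Implicit Arguments.
Unset Strict Implicit.
Unset Printing Implicit Defensive.

Import Order.TTheory GRing.Theory Num.Theory numFieldNormedType.Exports.

Local Open Scope classical_set_scope.
Local Open Scope ring_scope.
Local Open Scope complex_scope.

Definition is_partition (n : nat) (s : seq nat) : bool :=
  [&& sorted geq s, all (fun x => 0 < x)%N s & sumn s == n].

(* [fset_set] is [fset0] on infinite sets; [in_partitions] below shows that
   this default value plays no role. *)
Definition partitions (n : nat) : {fset seq nat} :=
  fset_set [set s | is_partition n s].

Lemma size_partition n s : is_partition n s -> (size s <= n)%N.
Proof.
case/and3P=> _ pos /eqP <-; elim: s pos => //= x s IHs /andP[x0 /IHs].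
by rewrite -addn1 addnC; apply: leq_add.
Qed.

Lemma part_leq n s : is_partition n s -> all (fun x => x < n.+1)%N s.
Proof.
case/and3P=> _ _ /eqP <-; apply/allP => x; elim: s => //= y s IHs.
rewrite inE ltnS => /predU1P[->|/IHs]; first exact: leq_addr.
by rewrite ltnS => /leq_trans; apply; apply: leq_addl.
Qed.

Lemma finite_partitions n : finite_set [set s | is_partition n s].
Proof.
apply: (@sub_finite_set _ _
  ((fun t : n.-bseq 'I_n.+1 => map val (t : seq 'I_n.+1)) @` setT)).
  move=> s /= ps; have szs := size_partition ps; have ltn := part_leq ps.
  have defs : map val (map (@inord n) s) = s.
    rewrite -map_comp -[RHS]map_id; apply/eq_in_map => x /(allP ltn) xn /=.
    by rewrite inordK.
  have szm : (size (map (@inord n) s) <= n)%N by rewrite size_map.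
  by exists (Bseq szm).
exact/finite_image/finite_finset.
Qed.

Lemma in_partitions n s : (s \in partitions n) = is_partition n s.
Proof.
rewrite /partitions in_fset_set; last exact: finite_partitions.
by apply/idP/idP; rewrite inE.
Qed.

Definition num_partitions (n : nat) : nat := #|` partitions n|.

Definition partition_norm (s : seq nat) : nat := (\prod_(x <- s) x)%N.

Definition expect {R : realType} (n : nat) (X : seq nat -> R) : R :=
  (\sum_(s <- partitions n) X s) / (num_partitions n)%:R.

Definition cexp {R : realType} (z : R[i]) : R[i] :=
  (expR (complex.Re z))%:C * (cos (complex.Im z) +i* sin (complex.Im z)).

(* The ascription [R[i]^o] selects the topology of the complex modulus. *)
Definition asymp_equiv {R : realType} (a b : nat -> R[i]) : Prop :=
  (a n / b n : R[i]^o) @[n --> \oo] --> (1 : R[i]^o).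

(* [3 `^ x] is a real power; the infinite product is the limit of its partial
   products, which converge since [k `^ l * 3 `^ (- k * l / 3)] is summable in
   [k] and different from 1 for [k != 3]. *)
Definition norm_const (R : realType) (l n0 : nat) : R[i] :=
  \sum_(1 <= j < 4)
    cexp (- (2 * pi * j%:R * n0%:R / 3 : R)%:C * 'i) *
    (3^-1 *
     lim ((\prod_(1 <= k < m | k != 3%N)
             (1 - (k%:R ^+ l * 3 `^ (- (k * l)%:R / 3) : R)%:C
                  * cexp ((2 * pi * j%:R * k%:R / 3 : R)%:C * 'i))^-1 : R[i]^o)
          @[m --> \oo])).

(* Main.v *)
(* Normalise each partition of n by giving a part k the weight
   x_k = k ^ l * 3 ^ (- k l / 3), so that the sum of N ^ l over the partitions
   of n is 3 ^ (l n / 3) w(n), where w(n) sums the products of weights.  The part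
   3 is the only one of weight 1, and all the others weigh less, summably.  Hence
   w(n) = v(n) + v(n - 3) + v(n - 6) + ..., where v only allows parts other than
   3, and w(n) tends along each residue class r mod 3 to A_r, the sum of v(m)
   over m = r mod 3.  For z ^ 3 = 1 the Euler product of 1 / (1 - x_k z ^ k)
   over k <> 3 equals A_0 + A_1 z + A_2 z ^ 2, so that Fourier inversion on Z/3
   identifies A_r with the constant of the theorem. *)

Require Import Defs.
From HB Require Import structures.
From mathcomp Require Import all_boot all_order all_algebra finmap.
From mathcomp Require Import all_classical all_reals all_analysis.
From mathcomp Require Import complex.
From mathcomp Require Import zify ring lra.

Set Implicit Arguments.
Unset Strict Implicit.
Unset Printing Implicit Defensive.

Import Order.TTheory GRing.Theory Num.Theory numFieldNormedType.Exports.

Local Open Scope classical_set_scope.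
Local Open Scope ring_scope.
Local Open Scope complex_scope.

(** * Partitions with bounded parts *)

Definition bounded_partitions (M n : nat) : seq (seq nat) :=
  [seq s <- partitions n | all (leq^~ M) s].

Lemma mem_bounded_partitions M n s :
  (s \in bounded_partitions M n) = is_partition n s && all (leq^~ M) s.
Proof. by rewrite mem_filter in_partitions andbC. Qed.

Lemma bounded_partitions_uniq M n : uniq (bounded_partitions M n).
Proof. exact/filter_uniq/fset_uniq. Qed.

Lemma is_partition_cons n k s :
  is_partition n (k :: s) =
  [&& (0 < k <= n)%N, all (leq^~ k) s & is_partition (n - k) s].
Proof.
rewrite /is_partition /= path_sortedE; last by move=> a b c; lia.
have [->|k0] := posnP k; first by rewrite !andbF.
rewrite -!andbA /=; have [kn|nk] := leqP k n; last first.
  by rewrite (_ : (_ == n) = false) ?andbF //; lia.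
rewrite (_ : (k + sumn s == n)%N = (sumn s == n - k)%N); last by lia.
by do !bool_congr.
Qed.

(** In a non-increasing list bounded by [M.+1], the part [M.+1] occurs exactly when it is the head.
    Removing that copy may leave further ones, so the bound stays [M.+1]. *)
Lemma bounded_partitionsS M n :
  perm_eq (bounded_partitions M.+1 n)
    (bounded_partitions M n ++
     (if (M < n)%N then map (cons M.+1) (bounded_partitions M.+1 (n - M.+1))
      else [::])).
Proof.
apply: uniq_perm; first exact: bounded_partitions_uniq.
  rewrite cat_uniq bounded_partitions_uniq; apply/andP; split => //.
  case: ifP => //= Mn; rewrite map_inj_uniq ?bounded_partitions_uniq ?andbT.
    apply/hasPn => _ /mapP[s _ ->]; rewrite mem_bounded_partitions /=.
    by rewrite ltnn /= andbF.
  by move=> a b [].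
move=> s; rewrite mem_cat !mem_bounded_partitions.
(* The default [0] of [head] differs from [M.+1], so the empty partition is not in the second
   list. *)
have -> : (s \in (if (M < n)%N
      then [seq M.+1 :: i | i <- bounded_partitions M.+1 (n - M.+1)] else [::]))
    = [&& is_partition n s & head 0%N s == M.+1].
  case: ifP => Mn.
    apply/mapP/idP => [[s' + ->]|].
      rewrite mem_bounded_partitions is_partition_cons Mn /= eqxx andbT.
      by move=> /andP[-> ->].
    case: s => [|k s]; first by rewrite andbF.
    rewrite is_partition_cons => /andP[/and3P[_ ks ps] /eqP /= kM].
    exists s; last by rewrite kM.
    by rewrite mem_bounded_partitions -kM ps.
  case: s => [|k s]; first by rewrite andbF.
  rewrite is_partition_cons /=.
  by apply/esym/negbTE/negP => /andP[/and3P[/andP[_ kn] _ _] /eqP kM]; lia.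
case: s => [|k s]; first by rewrite /= andbF orbF.
rewrite is_partition_cons -andb_orr /=.
case ks: (all (leq^~ k) s); rewrite ?andbF //=; congr (_ && _).
have allW N : (k <= N)%N -> all (leq^~ N) s.
  by move=> kN; apply: sub_all ks => x /leq_trans; apply.
have [kM|kM] := leqP k M; first by rewrite !allW //; lia.
rewrite orFb; have [kM'|] := eqVneq k M.+1; first by rewrite kM' leqnn -kM' ks.
by move=> kM'; rewrite leqNgt (_ : (M.+1 < k)%N) //; lia.
Qed.

(** * Weighted partition sums and their recurrences *)

Section PartSum.
Variable R : comNzRingType.
Implicit Types y : nat -> R.

(** The coefficient of [q ^ n] in the product of [1 / (1 - y k * q ^ k)] over [1 <= k <= M]. *)
Definition part_sum y (M n : nat) : R :=
  \sum_(s <- bounded_partitions M n) \prod_(x <- s) y x.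

Lemma part_sum0 y n : part_sum y 0 n = (n == 0%N)%:R.
Proof.
have perm0 : perm_eq (bounded_partitions 0 n) (if n == 0%N then [:: [::]] else [::]).
  apply: uniq_perm; [exact: bounded_partitions_uniq|by case: ifP|].
  move=> s; rewrite mem_bounded_partitions; case: s => [|k s].
    by rewrite andbT /is_partition /= eq_sym; case: ifP.
  rewrite is_partition_cons /= (_ : _ && _ = false); first by case: ifP.
  by case: k => [|k]; rewrite ?andbF.
rewrite /part_sum (perm_big _ perm0) /=; case: eqP => _.
  by rewrite big_seq1 big_nil.
by rewrite big_nil.
Qed.

(** Coefficient form of multiplying by [1 - y M.+1 * q ^ M.+1]; the guard [M < n] keeps truncated
    subtraction from adding spurious terms. *)
Lemma part_sumS y M n : part_sum y M.+1 n = part_sum y M n +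
  (if (M < n)%N then y M.+1 * part_sum y M.+1 (n - M.+1) else 0).
Proof.
rewrite /part_sum (perm_big _ (bounded_partitionsS M n)) big_cat /=; congr (_ + _).
case: ifP => _; last by rewrite big_nil.
by rewrite big_map big_distrr /=; apply: eq_bigr => s _; rewrite big_cons.
Qed.

Lemma part_sum_stable y M n : (n <= M)%N -> part_sum y M n = part_sum y n n.
Proof.
elim: M => [|M IH]; first by rewrite leqn0 => /eqP ->.
rewrite leq_eqVlt ltnS => /predU1P[-> //|nM].
by rewrite part_sumS ltnNge nM addr0 IH.
Qed.

Lemma part_sumE y n :
  part_sum y n n = \sum_(s <- partitions n) \prod_(x <- s) y x.
Proof.
rewrite /part_sum big_filter big_seq_cond [RHS]big_seq; apply: eq_bigl => s.
rewrite in_partitions; apply: andb_idr => /part_leq.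
by apply: sub_all => x; rewrite ltnS.
Qed.

Lemma eq_part_sum y y' M n : {in [pred k | (0 < k <= M)%N], y =1 y'} ->
  part_sum y M n = part_sum y' M n.
Proof.
elim: M n => [|M IH] n yy'; first by rewrite !part_sum0.
have {}IH p : part_sum y M p = part_sum y' M p.
  by apply: IH => k kM; apply: yy'; move: kM; rewrite !inE; lia.
have [p] := ubnP n; elim: p n => // p IHp n np.
rewrite (part_sumS y M n) (part_sumS y' M n) IH; case: ifP => // Mn; rewrite yy' ?inE ?leqnn // IHp //.
lia.
Qed.

Definition drop_part (a : nat) y : nat -> R := fun k => if k == a then 0 else y k.

(* Multiplying the generating function by [1 - q ^ a] removes the part [a],
   whose weight is [1]. *)
Lemma part_sum_drop (a : nat) y M n : (0 < a)%N -> y a = 1 -> (a <= M)%N ->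
  part_sum y M n = part_sum (drop_part a y) M n +
    (if (a <= n)%N then part_sum y M (n - a) else 0).
Proof.
move=> a0 ya; elim: M n => [|M IH] n; first by lia.
rewrite leq_eqVlt ltnS => /predU1P[aM|aM].
  rewrite {1}part_sumS [in RHS]part_sumS -aM ya /drop_part eqxx mul0r mul1r.
  rewrite if_same addr0 (@eq_part_sum y (drop_part a y)) => [|k]; last first.
    by rewrite inE /drop_part; case: eqP => //; lia.
  by [].
have yM : drop_part a y M.+1 = y M.+1.
  by rewrite /drop_part; case: eqP => // Ma; lia.
have [p] := ubnP n; elim: p n => // p IHp n np.
rewrite (part_sumS y M n) (part_sumS (drop_part a y) M n) yM IH //.
have [an|na] := leqP a n; last first.
  by rewrite (_ : (M < n)%N = false) ?addr0 //; lia.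
rewrite (part_sumS y M (n - a)); have [Mn|nM] := ltnP M n; last first.
  by rewrite (_ : (M < n - a)%N = false) ?addr0 //; lia.
rewrite IHp; last lia.
rewrite (_ : (a <= n - M.+1)%N = (M < n - a)%N); last by lia.
rewrite (_ : (n - M.+1 - a)%N = (n - a - M.+1)%N); last by lia.
by case: ifP => _; ring.
Qed.

(** The same recurrence for truncated generating functions: the shift by [M.+1] shortens the last
    sum, which is empty once [N <= M.+1]. *)
Lemma sum_part_sumS y M N z :
  \sum_(0 <= m < N) part_sum y M.+1 m * z ^+ m =
  \sum_(0 <= m < N) part_sum y M m * z ^+ m +
  y M.+1 * z ^+ M.+1 * \sum_(0 <= m < N - M.+1) part_sum y M.+1 m * z ^+ m.
Proof.
under eq_bigr do rewrite part_sumS mulrDl.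
rewrite big_split /=; congr (_ + _); rewrite big_distrr /=.
have [NM|MN] := leqP N M.+1.
  rewrite (eqP NM) [RHS]big_nil big_nat big1 // => m mN.
  by rewrite (_ : (M < m)%N = false) ?mul0r //; lia.
rewrite (@big_cat_nat _ _ _ M.+1) //=; last exact: ltnW.
rewrite big_nat big1 ?add0r => [|m mN]; last first.
  by rewrite (_ : (M < m)%N = false) ?mul0r //; lia.
rewrite -[X in \sum_(X <= _ < _) _]add0n big_addn; apply: eq_bigr => m _.
rewrite (_ : (M < m + M.+1)%N) ?addnK ?exprD; last by lia.
by ring.
Qed.

End PartSum.

Lemma rmorph_part_sum (R S : comNzRingType) (f : {rmorphism R -> S})
    (y : nat -> R) M n :
  f (part_sum y M n) = part_sum (f \o y) M n.
Proof.
by rewrite /part_sum rmorph_sum; apply: eq_bigr => s _; rewrite rmorph_prod.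
Qed.

(** * Convergence of the residue sums and the Euler product *)

Section Convergence.
Variables (R : realType) (y : nat -> R) (K0 : nat).
Hypothesis K0_gt0 : (0 < K0)%N.
Hypothesis y_ge0 : forall k, 0 <= y k.
Hypothesis y_lt1 : forall k, (0 < k)%N -> y k < 1.
Hypothesis y_tail : forall k, (K0 <= k)%N -> k%:R ^+ 2 * y k <= 1.

Let part_sum_ge0 M n : 0 <= part_sum y M n.
Proof. by apply: sumr_ge0 => s _; apply: prodr_ge0 => x _; apply: y_ge0. Qed.

Lemma part_sum_homo M M' n : (M <= M')%N -> part_sum y M n <= part_sum y M' n.
Proof.
move=> /subnK <-; elim: (M' - M)%N => // d /le_trans; apply.
rewrite addSn part_sumS lerDl; case: ifP => // _.
by rewrite mulr_ge0.
Qed.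

Lemma part_sum_le_diag M n : part_sum y M n <= part_sum y n n.
Proof.
have [nM|/ltnW] := leqP n M; first by rewrite part_sum_stable.
exact: part_sum_homo.
Qed.

(** The truncated generating function at [q = 1]; a bound uniform in [M] and [N] makes the residue
    sums converge. *)
Let total M N := \sum_(0 <= m < N) part_sum y M m.

Let total_ge0 M N : 0 <= total M N. Proof. exact: sumr_ge0. Qed.

Let total_homo M M' N : (M <= M')%N -> total M N <= total M' N.
Proof. by move=> MM'; apply: ler_sum => m _; apply: part_sum_homo. Qed.

Let total_mono M : {homo total M : N N' / (N <= N')%N >-> N <= N'}.
Proof.
move=> N N' NN'; rewrite /total [leRHS](@big_cat_nat _ _ _ N) //= lerDl.
exact: sumr_ge0.
Qed.

Let totalS M N : total M.+1 N * (1 - y M.+1) <= total M N.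
Proof.
have E M' N' : \sum_(0 <= m < N') part_sum y M' m * 1 ^+ m = total M' N'.
  by apply: eq_bigr => m _; rewrite expr1n mulr1.
have := sum_part_sumS y M N 1; rewrite !E expr1n mulr1 => totE.
have : y M.+1 * total M.+1 (N - M.+1) <= y M.+1 * total M.+1 N.
  by rewrite ler_wpM2l // total_mono // leq_subr.
by lra.
Qed.

Let total_bounded_at M : exists B, forall N, total M N <= B.
Proof.
elim: M => [|M [B tB]].
  exists 1 => N; rewrite /total.
  apply: (@le_trans _ _ (total 0 N.+1)); first exact: total_mono.
  rewrite /total big_nat_recl // part_sum0 big1 ?addr0 // => m _.
  by rewrite part_sum0.
have y1 : 0 < 1 - y M.+1 by rewrite subr_gt0 y_lt1.
exists (B / (1 - y M.+1)) => N; rewrite ler_pdivlMr //.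
exact: le_trans (totalS _ _) (tB N).
Qed.

(* Past [K0] the factor [1 - y k] is at least [1 - k ^- 2], and the product of
   these lower bounds telescopes. *)
Let total_tail d N : total (K0 + d) N * ((K0 + d).+1%:R / (K0 + d)%:R)
   <= total K0 N * (K0.+1%:R / K0%:R).
Proof.
elim: d => [|d]; first by rewrite addn0.
apply: le_trans; rewrite addnS; set k := (K0 + d)%N.
have k0 : 0 < k%:R :> R by rewrite ltr0n /k; lia.
have yk : k.+1%:R ^+ 2 * y k.+1 <= 1 by apply: y_tail; rewrite /k; lia.
have tS : total k.+1 N * (1 - y k.+1) * k.+1%:R ^+ 2 <= total k N * k.+1%:R ^+ 2.
  by rewrite ler_wpM2r ?exprn_ge0.
have ty : total k.+1 N * (k.+1%:R ^+ 2 * y k.+1) <= total k.+1 N.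
  by rewrite ler_piMr.
have k1 : k.+1%:R = k%:R + 1 :> R by rewrite -natr1.
rewrite -(natr1 k.+1) !mulrA ler_pdivrMr ?ltr0n //.
rewrite [leRHS]mulrAC ler_pdivlMr //.
move: tS ty; rewrite k1; lra.
Qed.

Let total_bounded : exists B, forall M N, total M N <= B.
Proof.
have [B tB] := total_bounded_at K0.
exists (B * (K0.+1%:R / K0%:R)) => M N.
apply: (@le_trans _ _ (total (K0 + M) N)); first by rewrite total_homo ?leq_addl.
apply: (@le_trans _ _ (total K0 N * (K0.+1%:R / K0%:R))); last first.
  by rewrite ler_wpM2r ?tB ?divr_ge0.
apply: le_trans (total_tail M N); rewrite ler_peMr // ler_pdivlMr ?ltr0n; last lia.
by rewrite mul1r ler_nat.
Qed.

(* Monotone convergence: the number of terms and the largest part allowed may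
   tend to infinity together or one after the other. *)
Lemma part_sum_cvg (P : pred nat) : exists (A : nat -> R) (Aoo : R),
  [/\ forall M, \sum_(0 <= m < N | P m) part_sum y M m @[N --> \oo] --> A M,
      \sum_(0 <= m < N | P m) part_sum y m m @[N --> \oo] --> Aoo,
      A M @[M --> \oo] --> Aoo &
      forall N, \sum_(0 <= m < N | P m) part_sum y m m <= Aoo].
Proof.
pose a M N := \sum_(0 <= m < N | P m) part_sum y M m.
pose d N := \sum_(0 <= m < N | P m) part_sum y m m.
have [B tB] := total_bounded.
have sub_le (F : nat -> R) : (forall m, 0 <= F m) ->
    {homo (fun N => \sum_(0 <= m < N | P m) F m) : N N' / (N <= N')%N >-> N <= N'}.
  move=> F0 N N' NN'; rewrite [leRHS](@big_cat_nat _ _ _ N) //= lerDl.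
  exact: sumr_ge0.
have a_homo M : {homo a M : N N' / (N <= N')%N >-> N <= N'} by exact: sub_le.
have d_homo : {homo d : N N' / (N <= N')%N >-> N <= N'} by exact: sub_le.
have ad M N : a M N <= d N by apply: ler_sum => m _; apply: part_sum_le_diag.
have dE N : d N = a N N.
  rewrite /d /a big_nat_cond [RHS]big_nat_cond.
  by apply: eq_bigr => m /andP[/andP[_ mN] _]; rewrite [RHS]part_sum_stable // ltnW.
have aB M N : a M N <= B.
  apply: le_trans (tB M N); rewrite /total (bigID P) /= lerDl.
  exact: sumr_ge0.
have a_cvg M : cvgn (a M).
  apply: nondecreasing_is_cvgn => //; exists B => _ [N _ <-]; exact: aB.
have d_cvg : cvgn d.
  apply: nondecreasing_is_cvgn => //; exists B => _ [N _ <-]; rewrite dE; exact: aB.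
exists (fun M => limn (a M)), (limn d); split => //; last exact: nondecreasing_cvgn_le.
(* Squeeze by [d M = a M M <= limn (a M) <= limn d]. *)
apply: (@squeeze_cvgr _ _ _ _ d (cst (limn d))) => //; last exact: cvg_cst.
near=> M; apply/andP; split.
  by rewrite dE; apply: nondecreasing_cvgn_le.
by apply: ler_lim => //; near=> N.
Unshelve. all: by end_near. Qed.

Lemma cvg_real_complex (u : nat -> R) (a : R) : u n @[n --> \oo] --> a ->
  ((u n)%:C : R[i]^o) @[n --> \oo] --> (a%:C : R[i]^o).
Proof.
move=> /cvgrPdist_lt ua; apply/cvgrPdist_lt => -[e e'].
(* A positive complex radius has zero imaginary part. *)
rewrite ltcE /= => /andP[/eqP -> e0]; near=> n.
rewrite -rmorphB normc_def /= expr0n addr0 sqrtr_sqr ltcE /= eqxx.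
by near: n; apply: ua.
Unshelve. all: by end_near. Qed.

Lemma sum_residues (z : R[i]) (F : nat -> R) N : z ^+ 3 = 1 ->
  \sum_(0 <= m < N) (F m)%:C * z ^+ m =
  \sum_(r < 3) (\sum_(0 <= m < N | (m %% 3 == r)%N) F m)%:C * z ^+ r.
Proof.
move=> z3; rewrite (partition_big (fun m => inord (m %% 3) : 'I_3) predT) //=.
apply: eq_bigr => r _; rewrite rmorph_sum big_distrl /=.
apply: eq_big => [m|m /eqP <-].
  by rewrite -val_eqE /= inordK // ltn_mod.
rewrite inordK ?ltn_mod //; congr (_ * _).
by rewrite {1}(divn_eq m 3) exprD mulnC exprM z3 expr1n mul1r.
Qed.

Lemma cvg_sum_residues (z : R[i]) (F : nat -> R) (A : nat -> R) : z ^+ 3 = 1 ->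
  (forall r, \sum_(0 <= m < N | (m %% 3 == r)%N) F m @[N --> \oo] --> A r) ->
  (\sum_(0 <= m < N) (F m)%:C * z ^+ m : R[i]^o) @[N --> \oo] -->
  (\sum_(r < 3) (A r)%:C * z ^+ r : R[i]^o).
Proof.
move=> z3 FA; under eq_fun do rewrite sum_residues //.
apply: cvg_big => [|r _]; first exact: add_continuous.
by apply: cvgM; [apply: cvg_real_complex|apply: cvg_cst].
Qed.

(** A cube root of unity has modulus 1, so [y k * z ^ k] has modulus [y k < 1]. *)
Lemma euler_factor_neq0 (z : R[i]) k : z ^+ 3 = 1 -> (0 < k)%N ->
  1 - (y k)%:C * z ^+ k != 0.
Proof.
move=> z3 k0; rewrite subr_eq0; apply/negP => /eqP yz.
have z1 : `|z| = 1.
  by apply/eqP; rewrite -(@pexpr_eq1 _ _ 3) // -normrX z3 normr1.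
have := y_lt1 k0; rewrite -ltcR.
have : `|(y k)%:C * z ^+ k| = 1 by rewrite -yz normr1.
rewrite normrM normrX z1 expr1n mulr1 ger0_norm ?ler0c // => ->.
by rewrite ltxx.
Qed.

(** Letting [N] tend to infinity in [sum_part_sumS] gives a linear equation for the value at [M.+1]
    in terms of that at [M]; the nonzero Euler factor makes it solvable. *)
Lemma euler_product (z : R[i]) (A : nat -> nat -> R) : z ^+ 3 = 1 ->
  (forall r M, \sum_(0 <= m < N | (m %% 3 == r)%N) part_sum y M m
     @[N --> \oo] --> A r M) ->
  forall M, \sum_(r < 3) (A r M)%:C * z ^+ r =
    \prod_(1 <= k < M.+1) (1 - (y k)%:C * z ^+ k)^-1.
Proof.
move=> z3 A_cvg M.
pose G M N : R[i]^o := \sum_(0 <= m < N) (part_sum y M m)%:C * z ^+ m.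
pose L M : R[i]^o := \sum_(r < 3) (A r M)%:C * z ^+ r.
have GL K : G K N @[N --> \oo] --> L K.
  exact: (@cvg_sum_residues z (part_sum y K) (A^~ K)).
rewrite -[LHS]/(L M); elim: M => [|M IH].
  rewrite big_geq //; apply: (@cvg_unique _ (@norm_hausdorff _ _) (G 0%N @ \oo) _ _ _ (GL 0%N)).
  apply: cvg_near_cst; near=> N.
  have N0 : (0 < N)%N by near: N; exists 1%N.
  rewrite /G -(prednK N0) big_nat_recl // part_sum0 mul1r big1 ?addr0 ?expr0 // => m _.
  by rewrite part_sum0 mul0r.
rewrite big_nat_recr //= -IH.
have yz := euler_factor_neq0 z3 (ltn0Sn M).
suff : L M.+1 = L M + (y M.+1)%:C * z ^+ M.+1 * L M.+1.
  move=> LS; apply: (mulIf yz); rewrite divfK // mulrBr mulr1.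
  by rewrite {1}LS; ring.
apply: (@cvg_unique _ (@norm_hausdorff _ _) (G M.+1 @ \oo) _ _ _ (GL M.+1)).
have -> : G M.+1 = fun N => G M N + (y M.+1)%:C * z ^+ M.+1 * G M.+1 (N - M.+1)%N.
  apply/funext => N; rewrite /G.
  (* [sum_part_sumS] works in a single ring, so the real weights are first mapped into [R[i]]. *)
  have C K p : \sum_(0 <= m < p) (part_sum y K m)%:C * z ^+ m =
      \sum_(0 <= m < p) part_sum (fun k => (y k)%:C) K m * z ^+ m.
    by apply: eq_bigr => m _; rewrite -(rmorph_part_sum (real_complex R)).
  rewrite !C.
  exact: sum_part_sumS.
apply: cvgD => //; apply: cvgM; first exact: cvg_cst.
by rewrite (cvg_centern M.+1 (G M.+1)).
Unshelve. all: by end_near. Qed.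

(** Here [M] tends to infinity in [euler_product]. The bound on partial sums serves to show the
    limits positive. *)
Lemma residue_sums_cvg : exists A : nat -> R, forall r : nat,
  [/\ \sum_(0 <= m < N | (m %% 3 == r)%N) part_sum y m m @[N --> \oo] --> A r,
      forall N, \sum_(0 <= m < N | (m %% 3 == r)%N) part_sum y m m <= A r &
      forall z : R[i], z ^+ 3 = 1 ->
        (\prod_(1 <= k < M) (1 - (y k)%:C * z ^+ k)^-1 : R[i]^o)
          @[M --> \oo] --> (\sum_(r < 3) (A r)%:C * z ^+ r : R[i]^o)].
Proof.
have /choice[A /choice[Aoo AP]] :=
  fun r : nat => part_sum_cvg (fun m => m %% 3 == r)%N.
exists Aoo => r; have [_ doo _ led] := AP r; split => // z z3.
rewrite -cvg_shiftS /=.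
have A_cvg r' M := let: And4 AM _ _ _ := AP r' in AM M.
under eq_fun do rewrite -(euler_product z3 A_cvg).
apply: cvg_big => [|r' _]; first exact: add_continuous.
have [_ _ Ar' _] := AP r'.
by apply: cvgM; [apply: cvg_real_complex|apply: cvg_cst].
Qed.

(** The partition into ones alone contributes [y 1 ^ n]. *)
Lemma part_sum_diag_gt0 n : 0 < y 1 -> 0 < part_sum y n n.
Proof.
move=> y1; apply: lt_le_trans (part_sum_le_diag 1 n).
by elim: n => [|n IH]; rewrite part_sumS part_sum0 ?addr0 // add0r subn1 mulr_gt0.
Qed.

End Convergence.

(** A partition of [n] is a partition of some [m] without threes, plus [(n - m) / 3] threes of
    weight 1. *)
Lemma part_sum_residue (R : comNzRingType) (y : nat -> R) n : y 3%N = 1 ->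
  part_sum y n n =
  \sum_(0 <= m < n.+1 | (m %% 3 == n %% 3)%N) part_sum (drop_part 3 y) m m.
Proof.
move=> y3.
have stepE m : part_sum y m m = part_sum (drop_part 3 y) m m +
    (if (3 <= m)%N then part_sum y (m - 3) (m - 3) else 0).
  (* The bound [m + 3] is at least 3 even for small [m], as [part_sum_drop] requires; stability then
     restores the diagonal. *)
  rewrite -(@part_sum_stable _ y (m + 3) m) ?leq_addr //.
  rewrite (@part_sum_drop _ 3) ?leq_addl // part_sum_stable ?leq_addr //.
  by rewrite (@part_sum_stable _ y (m + 3) (m - 3)) //; lia.
have [p] := ubnP n; elim: p n => // p IH n np.
rewrite stepE big_mkcond big_nat_recr //= eqxx addrC; congr (_ + _).
case: n np => [|[|[|n]]] np /=.
- by rewrite big_geq.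
- by rewrite big_nat1.
- by rewrite !big_nat_recr //= big_geq // !addr0.
rewrite !subSS subn0 IH; last lia.
(* The indices [n.+1] and [n.+2] lie in the other two residue classes. *)
rewrite !(big_nat_recr n.+2) //= !(big_nat_recr n.+1) //=.
rewrite !ifF ?addr0; [|lia..].
by rewrite -big_mkcond; apply: eq_bigl => m; congr (_ == _); lia.
Qed.

(** * The normalised weights of the parts *)

Section Weights.
Variables (R : realType) (l : nat).
Hypothesis l_gt0 : (1 <= l)%N.

(** With the cube root of 3, real powers become natural ones, and cubing turns bounds on weights
    into integer inequalities. *)
Let theta : R := 3 `^ 3^-1.

Let theta_gt0 : 0 < theta. Proof. exact: powR_gt0. Qed.

Let theta3 : theta ^+ 3 = 3.
Proof. by rewrite -powR_mulrn ?ltW // -powRrM mulVf ?powRr1. Qed.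

Let powR3 n : 3 `^ (n%:R / 3) = theta ^+ n.
Proof. by rewrite -powR_mulrn ?ltW // -powRrM mulrC. Qed.

Definition weight (k : nat) : R := k%:R ^+ l * 3 `^ (- (k * l)%:R / 3).

Let weightE k : weight k = (k%:R / theta ^+ k) ^+ l.
Proof. by rewrite /weight mulNr powRN powR3 expr_div_n -exprM. Qed.

Lemma weight3 : weight 3 = 1.
Proof. by rewrite weightE theta3 divff ?expr1n. Qed.

Lemma weight_ge0 k : 0 <= weight k.
Proof. by rewrite weightE exprn_ge0 // divr_ge0 // exprn_ge0 // ltW. Qed.

Lemma weight1_gt0 : 0 < weight 1.
Proof. by rewrite weightE exprn_gt0 // divr_gt0 // exprn_gt0. Qed.

(** Cubed form of [k < theta ^ k]. *)
Let cube_lt k : (0 < k)%N -> k != 3 -> (k ^ 3 < 3 ^ k)%N.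
Proof.
case: k => [|[|[|[|k]]]] // _ _; elim: k => // k IH.
by rewrite [in ltnRHS]expnS; nia.
Qed.

Let ninth_power_le k : (27 <= k)%N -> (k ^ 9 <= 3 ^ k)%N.
Proof.
move=> /subnK <-; elim: (k - 27)%N => [|d IH].
  have E : 27%N = (3 ^ 3)%N by [].
  by rewrite add0n {1}E -expnM leq_exp2l.
set m := (d + 27)%N in IH *; rewrite addSn -/m (expnS 3).
apply: leq_trans _ (leq_mul (leqnn 3) IH).
have m27 : (27 <= m)%N by rewrite leq_addl.
(* Cubed, this bounds [(m.+1 / m) ^ 9] by [216 / 125], below the factor 3 gained by [3 ^ m]. *)
have : (5 * m.+1 ^ 3 <= 6 * m ^ 3)%N by nia.
rewrite (_ : 9 = 3 * 3)%N // !expnM; move: (m.+1 ^ 3)%N (m ^ 3)%N => a b.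
rewrite -(@leq_exp2r _ _ 3) // (expnMn 5) (expnMn 6).
by move: (a ^ 3)%N (b ^ 3)%N => c d'; lia.
Qed.

Let ratio_le (c k : nat) : (k ^ (3 * c) <= 3 ^ k)%N ->
  k%:R ^+ c <= theta ^+ k.
Proof.
move=> kc; rewrite -(@ler_pXn2r _ 3) // ?nnegrE ?exprn_ge0 // ?(ltW theta_gt0) //.
by rewrite (exprAC theta) theta3 -exprM mulnC -!natrX ler_nat.
Qed.

Lemma weight_lt1 k : (0 < k)%N -> k != 3%N -> weight k < 1.
Proof.
move=> k0 k3; have q0 : 0 <= k%:R / theta ^+ k by rewrite divr_ge0 // exprn_ge0 // ltW.
rewrite weightE exprn_ilt1 //; first by rewrite -lt0n.
rewrite ltr_pdivrMr ?exprn_gt0 // mul1r -(@ltr_pXn2r _ 3) ?nnegrE ?exprn_ge0 ?(ltW theta_gt0) //.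
by rewrite (exprAC theta) theta3 -!natrX ltr_nat cube_lt.
Qed.

(* For [l = 1] this amounts to [k ^ 9 <= 3 ^ k], an equality at [k = 27]. *)
Lemma weight_tail k : (27 <= k)%N -> k%:R ^+ 2 * weight k <= 1.
Proof.
move=> k27; have k0 : (0 < k)%N by lia.
have k3le : k%:R ^+ 3 <= theta ^+ k by apply: ratio_le; rewrite ?ninth_power_le.
have t0 : 0 < theta ^+ k by rewrite exprn_gt0.
have q0 : 0 <= k%:R / theta ^+ k by rewrite divr_ge0 // ltW.
have q1 : k%:R / theta ^+ k <= 1.
  rewrite ler_pdivrMr // mul1r; apply: le_trans k3le.
  by rewrite ler_eXnr // ler1n.
(* Since [k / theta ^ k <= 1], its [l]-th power is at most itself, which reduces to [l = 1]. *)
apply: (@le_trans _ _ (k%:R ^+ 2 * (k%:R / theta ^+ k))).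
  by rewrite ler_wpM2l ?exprn_ge0 // weightE -[leRHS]expr1 ler_wiXn2l.
by rewrite mulrA -exprSr ler_pdivrMr // mul1r.
Qed.

(** The parts add up to [n], so the powers of [theta] collect into [theta ^ (l * n)]. *)
Lemma prod_weight n s : is_partition n s ->
  \prod_(x <- s) weight x =
  (partition_norm s)%:R ^+ l / 3 `^ (l%:R * n%:R / 3).
Proof.
move=> /and3P[_ _ /eqP <-]; rewrite -natrM powR3 /partition_norm.
elim: s => [|x s IH]; first by rewrite !big_nil muln0 expr1n divr1.
rewrite !big_cons IH weightE natrM /= mulnDr exprD expr_div_n exprMn -exprM.
by rewrite (mulnC x) invfM; ring.
Qed.

Lemma sum_partition_norm n :
  \sum_(s <- partitions n) (partition_norm s)%:R ^+ l =
  3 `^ (l%:R * n%:R / 3) * part_sum weight n n.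
Proof.
rewrite part_sumE big_distrr /= big_seq [RHS]big_seq; apply: eq_bigr => s.
rewrite in_partitions => /prod_weight ->; rewrite mulrC divfK //.
Qed.

End Weights.

(* Fourier inversion on Z/3: [(z ^+ j) ^+ (2 * n)] is [(z ^+ j) ^- n]. *)
Lemma cube_root_orth (C : numFieldType) (z : C) (A : nat -> C) n :
  z ^+ 3 = 1 -> z ^+ 2 = - 1 - z -> (n < 3)%N ->
  \sum_(1 <= j < 4) (z ^+ j) ^+ (2 * n) *
     (3^-1 * \sum_(r < 3) A r * (z ^+ j) ^+ r) = A n.
Proof.
move=> z3 z2 n3.
suff E : \sum_(1 <= j < 4) (z ^+ j) ^+ (2 * n) *
     (\sum_(r < 3) A r * (z ^+ j) ^+ r) = 3 * A n.
  rewrite -[RHS](mulKf (_ : 3 != 0)) ?pnatr_eq0 // -E [RHS]big_distrr /=.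
  by apply: eq_bigr => j _; rewrite mulrCA.
rewrite 3?big_ltn // big_geq // addr0 z3 z2 expr1.
case: n n3 => [|[|[|]]] // _; rewrite !big_ord_recl !big_ord0 /= /bump /=.
- by ring: z2.
- by ring: z2.
- by ring: z2.
Qed.

(** * Cube roots of unity as complex exponentials *)

Section CubeRoots.
Variable R : realType.

Let cis (x : R) : R[i] := cos x +i* sin x.

Let cisD x x' : cis (x + x') = cis x * cis x'.
Proof. by rewrite /cis cosD sinD; simpc; congr (_ +i* _); ring. Qed.

Let cis0 : cis 0 = 1. Proof. by rewrite /cis cos0 sin0. Qed.

Let cisX x n : cis (x * n%:R) = cis x ^+ n.
Proof.
elim: n => [|n IH]; first by rewrite mulr0 cis0.
by rewrite -natr1 mulrDr mulr1 cisD IH exprSr.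
Qed.

Let cexp_imaginary (x : R) : cexp (x%:C * 'i) = cis x.
Proof.
rewrite /cexp -complexiE; simpc => /=.
by rewrite expR0 !mul1r.
Qed.

Definition cube_root1 : R[i] := cis (2 * pi / 3).
Local Notation zeta := cube_root1.

Lemma cube_root1X3 : zeta ^+ 3 = 1.
Proof. by rewrite -cisX divfK // /cis mulr_natl cos2pi sin2pi. Qed.

(** Cancel [zeta - 1] in [zeta ^ 3 - 1 = 0]; it is nonzero because [cos] is injective on
    [[0, pi]]. *)
Lemma cube_root1_sum : zeta ^+ 2 = - 1 - zeta.
Proof.
have z1 : zeta - 1 != 0.
  rewrite subr_eq0; apply/eqP => -[cos1 _].
  have pi0 := pi_gt0 R.
  have I0 : 0 \in `[0, pi : R] by rewrite in_itv /= lexx ltW.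
  have I1 : 2 * pi / 3 \in `[0, pi : R] by rewrite in_itv /=; apply/andP; split; lra.
  by have := cos_inj I1 I0; rewrite cos1 cos0 => /(_ erefl); lra.
apply: (mulfI z1); have := cube_root1X3; rewrite !exprS expr0 mulr1 => z3.
by rewrite mulrBl z3 mul1r; ring.
Qed.

Lemma cexp_cube_root j k :
  cexp ((2 * pi * j%:R * k%:R / 3 : R)%:C * 'i) = (zeta ^+ j) ^+ k.
Proof.
rewrite cexp_imaginary -exprM -cisX; congr cis.
by rewrite natrM; ring.
Qed.

Lemma cexpN_cube_root j k :
  cexp (- (2 * pi * j%:R * k%:R / 3 : R)%:C * 'i) = (zeta ^+ j) ^+ (2 * k).
Proof.
set x : R := _ / 3; have cisx : cis x = (zeta ^+ j) ^+ k.
  by rewrite -cexp_imaginary cexp_cube_root.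
have -> : - x%:C = (- x)%:C by rewrite rmorphN.
have x0 : cis x != 0.
  by apply/eqP => cx0; have := cisD x (- x); rewrite subrr cis0 cx0 mul0r => /eqP; rewrite oner_eq0.
rewrite cexp_imaginary; apply: (mulfI x0); rewrite -cisD subrr cis0 cisx.
by rewrite -exprD -mulSn -exprM mulnCA exprM cube_root1X3 expr1n.
Qed.

End CubeRoots.

(** * The asymptotic formula *)

Lemma num_partitions_gt0 n : (0 < num_partitions n)%N.
Proof.
rewrite /num_partitions cardfs_gt0; apply/fset0Pn; exists (nseq n 1%N).
rewrite in_partitions /is_partition sumn_nseq mul1n eqxx all_nseq orbT andbT.
by rewrite andbT; elim: n => [|[|n]].
Qed.

Theorem theorem1 (R : realType) (l : nat) (hl : (1 <= l)%N) :
  asymp_equiv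
    (fun n : nat =>
       (expect n (fun s => (partition_norm s)%:R ^+ l) : R)%:C)
    (fun n : nat =>
       norm_const R l (n %% 3) *
       (3 `^ (l%:R * n%:R / 3) / (num_partitions n)%:R : R)%:C).
Proof.
pose y := drop_part 3 (@weight R l).
have y_ge0 k : 0 <= y k by rewrite /y /drop_part; case: ifP => _; rewrite ?weight_ge0.
have y_lt1 k : (0 < k)%N -> y k < 1.
  by rewrite /y /drop_part => k0; case: eqP => // /eqP; apply: weight_lt1.
have y_tail k : (27 <= k)%N -> k%:R ^+ 2 * y k <= 1.
  move=> k27; rewrite /y /drop_part ifF; first exact: weight_tail.
  by apply/negP => /eqP; lia.
have [A AP] := residue_sums_cvg (isT : (0 < 27)%N) y_ge0 y_lt1 y_tail.
have norm_constE r : (r < 3)%N -> norm_const R l r = (A r)%:C.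
  move=> r3; have [_ _ prod_cvg] := AP r.
  rewrite -(cube_root_orth (fun r => (A r)%:C) (cube_root1X3 R) (cube_root1_sum R) r3).
  apply: eq_bigr => j _; rewrite cexpN_cube_root; congr (_ * (_ * _)).
  apply: (@cvg_lim R[i]^o); first exact: norm_hausdorff.
  have zj : (cube_root1 R ^+ j) ^+ 3 = 1 by rewrite exprAC cube_root1X3 expr1n.
  apply: cvg_trans (prod_cvg _ zj); apply: near_eq_cvg; near=> M.
  (* As [y 3 = 0], the factor at [k = 3] is 1, which matches its omission in [norm_const]. *)
  rewrite [RHS]big_mkcond; apply: eq_bigr => k _.
  rewrite cexp_cube_root /y /drop_part -[in LHS]/(weight R l k).
  by case: eqP => //= _; rewrite mul0r subr0 invr1.
pose d r N := \sum_(0 <= m < N | (m %% 3 == r)%N) part_sum y m m.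
have wE n : part_sum (@weight R l) n n = d (n %% 3)%N n.+1.
  exact/part_sum_residue/weight3.
have A_gt0 n : 0 < A (n %% 3)%N.
  have [_ led _] := AP (n %% 3)%N; apply: lt_le_trans (led n.+1).
  (* The term [m = n] is already positive, because the part 1 has positive weight. *)
  rewrite big_mkcond big_nat_recr //= eqxx ltr_wpDl //.
    apply: sumr_ge0 => m _; case: ifP => // _.
    by apply: sumr_ge0 => s _; apply: prodr_ge0.
  by apply: (part_sum_diag_gt0 y_ge0); apply: weight1_gt0.
(* The power of 3 and the number of partitions cancel, leaving a partial sum over its limit. *)
have ratioE n : (expect n (fun s => (partition_norm s)%:R ^+ l) : R)%:C /
    (norm_const R l (n %% 3) *
       (3 `^ (l%:R * n%:R / 3) / (num_partitions n)%:R : R)%:C) =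
    (d (n %% 3)%N n.+1 / A (n %% 3)%N)%:C.
  rewrite norm_constE ?ltn_mod // -rmorphM -fmorph_div; congr (_ %:C).
  rewrite /expect sum_partition_norm -wE.
  have p0 : (num_partitions n)%:R != 0 :> R by rewrite pnatr_eq0 -lt0n num_partitions_gt0.
  have t0 : 3 `^ (l%:R * n%:R / 3) != 0 :> R by rewrite gt_eqF ?powR_gt0.
  have A0 : A (n %% 3)%N != 0 by rewrite gt_eqF.
  by field; rewrite p0 t0 A0.
rewrite /asymp_equiv; under eq_fun do rewrite ratioE.
apply: cvg_real_complex; apply/cvgrPdist_lt => e e0.
(* The residue of the index varies along the limit, so each class gets its own eventual bound and
   the three are then combined. *)
have d_cvg n : \forall N \near \oo, `|1 - d (n %% 3)%N N.+1 / A (n %% 3)%N| < e.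
  have [dA _ _] := AP (n %% 3)%N; move: dA; rewrite -cvg_shiftS => dA.
  have cv : d (n %% 3)%N N.+1 / A (n %% 3)%N @[N --> \oo] --> (1 : R).
    by rewrite -(divff (lt0r_neq0 (A_gt0 n))); apply: cvgM => //; apply: cvg_cst.
  by move/cvgrPdist_lt: cv; apply.
near=> n.
have : (n %% 3 < 3)%N by rewrite ltn_mod.
case nE : (n %% 3)%N => [|[|[|r]]] // _.
- by near: n; apply: (d_cvg 0%N).
- by near: n; apply: (d_cvg 1%N).
- by near: n; apply: (d_cvg 2%N).
Unshelve. all: by end_near. Qed.
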